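(* Let $m\in\mathbb{N}$, $0< p, q_1, \dots, q_m \leq \infty$, $1 \leq r \leq \infty$, and let $T\colon L^{q_1}(\mu_1)\times \cdots \times L^{q_m}(\mu_m) \to L^p(\nu)$ be a positive multilinear operator. Then $$\left\|\left(\sum_{k_1, \dots, k_m} |T(f_{k_1}^1, \dots, f_{k_m}^m)|^r\right)^{1/r}\right\|_{L^p(\nu)} \leq \|T\| \prod_{i=1}^m \left\| \left(\sum_{k_i=1}^{n_i} |f_{k_i}^i|^r\right)^{1/r} \right\|_{L^{q_i}(\mu_i)}$$ for any $n_1,\dots,n_m\in\mathbb{N}$ and any choice of functions $\{f_{k_i}^i\}_{k_i=1}^{n_i} \subset L^{q_i}(\mu_i)$, $1\leq i \leq m$.
   Context: All measures are $\sigma$-finite and all $L^p$ spaces are real. The $m$-linear operator $T$ is called positive if $f^1,\dots,f^m\ge 0$ implies $T(f^1,\dots,f^m)\ge 0$. $\|T\|$ is the smallest constant $M$ with $\|T(f^1,\dots,f^m)\|_{L^p(\nu)}\le M\prod_{i=1}^m\|f^i\|_{L^{q_i}(\mu_i)}$ for all $f^i\in L^{q_i}(\mu_i)$. When $r=\infty$, the expressions $(\sum|\cdot|^r)^{1/r}$ are replaced by suprema. *)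

(* Defs.v *)
From HB Require Import structures.
From mathcomp Require Import all_boot all_order all_algebra.
From mathcomp Require Import all_classical all_reals all_analysis.

Set Implicit Arguments.
Unset Strict Implicit.
Unset Printing Implicit Defensive.

Import Order.TTheory GRing.Theory Num.Theory.
Import numFieldNormedType.Exports.

Local Open Scope classical_set_scope.
Local Open Scope ring_scope.

(* The quantity (\sum_k |a k|^r)^(1/r) of a finite real family, read as the
   supremum of the |a k| when r = +oo; the value at r = -oo is irrelevant. *)
Definition fin_lnorm (R : realType) (I : finType) (r : \bar R) (a : I -> R) : R :=
  match r with
  | s%:E => (\sum_(k : I) `|a k| `^ s) `^ s^-1
  | +oo%E => \big[Num.max/0]_(k : I) `|a k|
  | -oo%E => 0
  end.

Section lp_operators.
Context (R : realType) (m : nat).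
Context (d : 'I_m -> measure_display) (X : forall i, measurableType (d i)).
Context (mu : forall i, {sigma_finite_measure set (X i) -> \bar R}).
Context (q : 'I_m -> \bar R).
Context (d' : measure_display) (Y : measurableType d').
Context (nu : {sigma_finite_measure set Y -> \bar R}) (p : \bar R).

Definition Lfun_tuple (f : forall i, X i -> R) : Prop :=
  forall i, f i \in Lfun (mu i) (q i).

(* An element of L^p is a class of functions in [Lfun _ p] modulo equality
   almost everywhere (the library's quotient [LspaceType] is restricted to
   1 <= p). An operator L^(q_1) x ... x L^(q_m) -> L^p is therefore given by a
   map T on representatives that is compatible with equality almost everywhere,
   every equation between values of T being an equality almost everywhere. What T
   does outside of [Lfun_tuple] is irrelevant. *)
Record multilinear_operator (T : (forall i, X i -> R) -> Y -> R) : Prop := {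
  multilinear_operator_Lfun : forall f, Lfun_tuple f -> T f \in Lfun nu p ;
  multilinear_operator_ae_eq : forall f g, Lfun_tuple f -> Lfun_tuple g ->
    (forall i, f i = g i %[ae mu i]) -> T f = T g %[ae nu] ;
  multilinear_operator_linear : forall f (i : 'I_m) (a : R) (u v : X i -> R),
    Lfun_tuple f -> u \in Lfun (mu i) (q i) -> v \in Lfun (mu i) (q i) ->
    T (dfwith f i (fun x => a * u x + v x)) =
    (fun y => a * T (dfwith f i u) y + T (dfwith f i v) y) %[ae nu]
}.

Definition positive_operator (T : (forall i, X i -> R) -> Y -> R) : Prop :=
  forall f, Lfun_tuple f ->
    (forall i, \forall x \ae mu i, 0 <= f i x) -> \forall y \ae nu, 0 <= T f y.

Definition operator_bound (T : (forall i, X i -> R) -> Y -> R) (M : R) : Prop :=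
  forall f, Lfun_tuple f ->
    ('N[nu]_p[EFin \o T f] <=
       M%:E * \big[*%E/1]_(i < m) 'N[mu i]_(q i)[EFin \o f i])%E.

(* It is +oo if T has no finite bound. *)
Definition operator_norm (T : (forall i, X i -> R) -> Y -> R) : \bar R :=
  ereal_inf [set M%:E | M in [set M : R | 0 <= M /\ operator_bound T M]].

End lp_operators.

(* Main.v *)
(* The l^r norm on a finite index set is the supremum of countably many linear
   forms with nonnegative weights. A positive operator acting on one slot, the
   other slots being filled with nonnegative functions, commutes with each of
   these forms, so almost everywhere the l^r norm of its values is at most its
   value at the l^r norm of the arguments. Applied to one slot after the other,
   starting from |T f| <= T |f|, this gives the almost everywhere bound
   (sum_k |T (f_k)|^r)^(1/r) <= T (F^1, ..., F^m), where F^i is the l^r norm of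
   the family (f^i_k)_k. It remains to take norms. *)
Require Import Defs.
From HB Require Import structures.
From mathcomp Require Import all_boot all_order all_algebra.
From mathcomp Require Import all_classical all_reals all_analysis.
From mathcomp Require Import measurable_realfun ess_sup_inf lra.

Set Implicit Arguments.
Unset Strict Implicit.
Unset Printing Implicit Defensive.

Import Order.TTheory GRing.Theory Num.Theory.
Import numFieldNormedType.Exports.

Local Open Scope classical_set_scope.
Local Open Scope ring_scope.

(** * The [l^r] norm of a finite family: comparison, Hoelder's inequality, norming weights *)

Section fin_lnorm.
Context {R : realType}.
Implicit Types (I J : finType) (r : \bar R) (s : R).

Lemma fin_lnorm_ge0 I r (a : I -> R) : 0 <= fin_lnorm r a.
Proof.
case: r => [s||] //=; first exact: powR_ge0.
by elim/big_ind : _ => // x y x0 y0; rewrite le_max x0.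
Qed.

Lemma powR_fin_lnorm I s (a : I -> R) : s != 0 ->
  fin_lnorm s%:E a `^ s = \sum_k `|a k| `^ s.
Proof.
move=> s0; rewrite /fin_lnorm -powRrM mulVf// powRr1//.
by apply: sumr_ge0 => k _; exact: powR_ge0.
Qed.

Lemma fin_lnorm_le I s (a : I -> R) A : 0 < s -> 0 <= A ->
  \sum_k `|a k| `^ s <= A `^ s -> fin_lnorm s%:E a <= A.
Proof.
move=> s0 A0 h; rewrite /fin_lnorm.
rewrite -[leRHS](powRr1 A0) -(mulfV (lt0r_neq0 s0)) powRrM.
apply: ge0_ler_powR => //; rewrite ?nnegrE ?powR_ge0 ?invr_ge0 ?(ltW s0)//.
by apply: sumr_ge0 => k _; exact: powR_ge0.
Qed.

Lemma normr_le_fin_lnorm I r (a : I -> R) k : (0 < r)%E ->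
  `|a k| <= fin_lnorm r a.
Proof.
case: r => [s| |] // s0; last exact: (le_bigmax 0 (fun k => `|a k|)).
rewrite lte_fin in s0.
rewrite -[leLHS]powRr1// -(mulfV (lt0r_neq0 s0)) powRrM.
apply: ge0_ler_powR; rewrite ?nnegrE ?powR_ge0 ?invr_ge0 ?(ltW s0)//.
- by apply: sumr_ge0 => j _; exact: powR_ge0.
- rewrite (bigD1 k)//= lerDl.
  by apply: sumr_ge0 => j _; exact: powR_ge0.
Qed.

Lemma le_fin_lnorm I r (a b : I -> R) : (0 < r)%E ->
  (forall k, `|a k| <= `|b k|) -> fin_lnorm r a <= fin_lnorm r b.
Proof.
case: r => [s| |] s0 ab; last by clear ab.
  rewrite lte_fin in s0.
  apply: fin_lnorm_le; rewrite ?fin_lnorm_ge0// powR_fin_lnorm ?gt_eqF//.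
  by apply: ler_sum => k _; apply: ge0_ler_powR; rewrite ?nnegrE ?(ltW s0).
apply: bigmax_le => [|k _]; first exact: (@fin_lnorm_ge0 _ +oo%E).
by apply: (le_trans (ab k)); exact: (@normr_le_fin_lnorm _ +oo%E).
Qed.

(** With [S] the sum on the right and [s >= 1], each [|a k| ^ s] is at most [S ^ (s - 1) * |a k|],
    and these bounds add up to [S ^ s]. *)
Lemma fin_lnorm_le_sum I r (a : I -> R) : (1 <= r)%E ->
  fin_lnorm r a <= \sum_k `|a k|.
Proof.
have S0 : 0 <= \sum_k `|a k| by exact: sumr_ge0.
have le1 k : `|a k| <= \sum_k `|a k|.
  by rewrite (bigD1 k)//= lerDl; exact: sumr_ge0.
case: r => [s| |] // s1; last by apply: bigmax_le.
rewrite lee_fin in s1; have s0 := lt_le_trans ltr01 s1.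
apply: fin_lnorm_le => //.
rewrite -(mulr_powRB1 S0 s0) mulr_suml; apply: ler_sum => k _.
rewrite -(mulr_powRB1 (normr_ge0 _) s0) ler_wpM2l//.
by apply: ge0_ler_powR; rewrite ?subr_ge0 ?nnegrE.
Qed.

(** The sum over [I] is grouped along the fibers of [h]; on the fiber over [l] the family [c l]
    dominates [b], and extending that inner sum to all of [I] only increases it. In the induction
    over slots, [h] reads off one coordinate of a multi-index. *)
Lemma fin_lnorm_fibers I J r (h : I -> J) (b : I -> R) (c : J -> I -> R) :
  (0 < r)%E -> (forall x, `|b x| <= `|c (h x) x|) ->
  fin_lnorm r b <= fin_lnorm r (fun l => fin_lnorm r (c l)).
Proof.
move=> r0 bc; case: r r0 => [s| |] // s0.
  rewrite lte_fin in s0.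
  apply: fin_lnorm_le; rewrite ?fin_lnorm_ge0// powR_fin_lnorm ?gt_eqF//.
  rewrite (partition_big h predT)//; apply: ler_sum => l _.
  rewrite ger0_norm ?fin_lnorm_ge0// powR_fin_lnorm ?gt_eqF//.
  rewrite [leRHS](bigID (fun x => h x == l))/= ler_wpDr//.
    by apply: sumr_ge0 => k _; exact: powR_ge0.
  apply: ler_sum => x /eqP <-.
  by apply: ge0_ler_powR; rewrite ?nnegrE ?(ltW s0).
apply: bigmax_le => [|x _]; first exact: (@fin_lnorm_ge0 _ +oo%E).
apply: (le_trans (bc x)).
apply: (le_trans (normr_le_fin_lnorm (c (h x)) x s0)).
apply: le_trans (normr_le_fin_lnorm (fun l => fin_lnorm +oo%E (c l)) (h x) s0).
by rewrite ger0_norm ?fin_lnorm_ge0.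
Qed.

Lemma sum_powR_le1 I s (x y : I -> R) : 1 < s ->
  (forall k, 0 <= x k) -> (forall k, 0 <= y k) ->
  \sum_k x k `^ s = 1 -> \sum_k y k `^ s = 1 ->
  \sum_k x k `^ (s - 1) * y k <= 1.
Proof.
move=> s1 x0 y0 x1 y1; have s10 : 0 < s - 1 by rewrite subr_gt0.
have s0 : 0 < s by exact: lt_trans s1.
(* [t] is the exponent conjugate to [s], so [(x ^ (s - 1)) ^ t = x ^ s]; Young's inequality is
   applied to each term and summed. *)
pose t := s / (s - 1); have t0 : 0 < t by rewrite divr_gt0.
have ts1 : t^-1 + s^-1 = 1.
  by rewrite /t invf_div mulrBl divff ?gt_eqF// mul1r subrK.
apply: (@le_trans _ _ (\sum_k (x k `^ s / t + y k `^ s / s))); last first.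
  by rewrite big_split/= -!mulr_suml x1 y1 2!mul1r ts1.
apply: ler_sum => k _.
have := conjugate_powR (powR_ge0 (x k) (s - 1)) (y0 k) t0 s0 ts1.
by rewrite -powRrM [(s - 1) * t]mulrC /t divfK ?gt_eqF.
Qed.

Lemma sum_powR_normalized I s (u : I -> R) N : 0 < s -> 0 < N ->
  N = fin_lnorm s%:E u -> \sum_k (`|u k| / N) `^ s = 1.
Proof.
move=> s0 N0 NE; under eq_bigr do rewrite powRM ?invr_ge0 ?(ltW N0)//.
rewrite -mulr_suml -powR_fin_lnorm ?gt_eqF// -NE -powRM ?invr_ge0 ?(ltW N0)//.
by rewrite mulfV ?gt_eqF// powR1.
Qed.

(** Hoelder's inequality, with one factor written as [c ^ (s - 1)] because equality then holds at
    [u = c]. Dividing both families by their norms reduces it to [sum_powR_le1]. *)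
Lemma fin_lnorm_hoelder I s (c u : I -> R) : 1 <= s -> (forall k, 0 <= c k) ->
  \sum_k c k `^ (s - 1) * `|u k| <=
    fin_lnorm s%:E c `^ (s - 1) * fin_lnorm s%:E u.
Proof.
move=> s1 c0; have s0 := lt_le_trans ltr01 s1.
(* For [s = 1] there is no finite conjugate exponent; all weights are then [1], including those with
   [c k = 0], as [0 ^ 0 = 1]. *)
have [s_eq1|s_neq1] := eqVneq s 1.
  rewrite {s1 s0}s_eq1 subrr powRr0 mul1r /fin_lnorm invr1 powRr1; last first.
    by apply: sumr_ge0 => k _; exact: powR_ge0.
  by apply: ler_sum => k _; rewrite powRr0 mul1r powRr1.
have {}s1 : 1 < s by rewrite lt_neqAle eq_sym s_neq1.
have s10 : 0 < s - 1 by rewrite subr_gt0.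
have cC k := normr_le_fin_lnorm c k (s0 : (0 < s%:E)%E).
have uU k := normr_le_fin_lnorm u k (s0 : (0 < s%:E)%E).
have C0 := fin_lnorm_ge0 s%:E c; have U0 := fin_lnorm_ge0 s%:E u.
move: cC C0 (@sum_powR_normalized I s c (fin_lnorm s%:E c) s0).
move: (fin_lnorm s%:E c) => C cC C0 Csum.
move: uU U0 (@sum_powR_normalized I s u (fin_lnorm s%:E u) s0).
move: (fin_lnorm s%:E u) => U uU U0 Usum.
have [C_eq0|C_neq0] := eqVneq C 0.
  rewrite big1 ?mulr_ge0 ?powR_ge0// => k _.
  suff -> : c k = 0 by rewrite powR0 ?mul0r ?gt_eqF.
  by apply/normr0_eq0/eqP; rewrite eq_le normr_ge0 andbT -C_eq0.
have [U_eq0|U_neq0] := eqVneq U 0.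
  rewrite big1 ?mulr_ge0 ?powR_ge0// => k _.
  suff -> : u k = 0 by rewrite normr0 mulr0.
  by apply/normr0_eq0/eqP; rewrite eq_le normr_ge0 andbT -U_eq0.
have Cp : 0 < C by rewrite lt0r C_neq0 C0.
have Up : 0 < U by rewrite lt0r U_neq0 U0.
have CUp : 0 < C `^ (s - 1) * U by apply: mulr_gt0 => //; exact: powR_gt0.
rewrite -[leRHS]mul1r -ler_pdivrMr// mulr_suml.
apply: le_trans (sum_powR_le1 s1 _ _ (Csum Cp erefl) (Usum Up erefl)).
- apply: ler_sum => k _.
  rewrite (ger0_norm (c0 k)) powRM ?invr_ge0//.
  by rewrite -[C^-1 in leRHS]powR_inv1// powRAC powR_inv1 ?powR_ge0// invfM mulrACA.
- by move=> k; apply: divr_ge0.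
- by move=> k; apply: divr_ge0.
Qed.

(* From above, so that the weights [c ^ (s - 1)] dominate [a ^ (s - 1)]. *)
Lemma rat_approx (a e : R) : 0 <= a -> 0 < e ->
  exists c : rat, a <= ratr c <= (1 + e) * a.
Proof.
move=> a0 e0; have [->|an0] := eqVneq a 0.
  by exists 0; rewrite rmorph0 mulr0 lexx.
have ap : 0 < a by rewrite lt_neqAle eq_sym an0.
have [c] : exists c : rat, ratr c \in `]a, (1 + e) * a[.
  by apply: rat_in_itvoo; rewrite mulrDl mul1r ltrDl mulr_gt0.
by rewrite in_itv/= => /andP[/ltW ac /ltW ca]; exists c; rewrite ac.
Qed.

Lemma rat_fin_lnorm_approx I s (a : I -> R) e :
  0 < s -> (forall k, 0 <= a k) -> 0 < e ->
  exists q : I -> rat, (forall k, a k <= ratr (q k)) /\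
    fin_lnorm s%:E (fun k => ratr (q k) : R) <= (1 + e) * fin_lnorm s%:E a.
Proof.
move=> s0 a0 e0; have e10 : 0 <= 1 + e by rewrite addr_ge0// ltW.
have /fin_all_exists[q hq] k := rat_approx (a0 k) e0.
exists q; split=> [k|]; first by have /andP[] := hq k.
apply: fin_lnorm_le; [by []|exact: mulr_ge0 e10 (fin_lnorm_ge0 _ _)|].
rewrite powRM ?fin_lnorm_ge0// powR_fin_lnorm ?gt_eqF// mulr_sumr.
apply: ler_sum => k _; rewrite -powRM//.
have /andP[aq qa] := hq k.
apply: ge0_ler_powR; rewrite ?nnegrE ?mulr_ge0 ?(ltW s0)//.
by rewrite !ger0_norm// (le_trans _ aq).
Qed.

(** [N] and [C] are meant as the norms of a family and of its rational approximation. Bounding [C]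
    by [(1 + e) N] and cancelling [N ^ (s - 1)] leaves the factor [(1 + e) ^ (s - 1)], which is
    relaxed to the exponent [s], positive even for [s = 1]. *)
Lemma le_of_powR_le s (N C A e : R) : 1 <= s -> 0 < N -> 0 <= C -> 0 <= e ->
  0 <= A -> C <= (1 + e) * N -> N `^ s <= C `^ (s - 1) * A ->
  N <= (1 + e) `^ s * A.
Proof.
move=> s1 N0 C0 e0 A0 CN NC; have s0 : 0 < s by exact: lt_le_trans s1.
have e10 : 0 <= 1 + e by rewrite addr_ge0.
have {}NC : N `^ s <= (1 + e) `^ (s - 1) * N `^ (s - 1) * A.
  apply: (le_trans NC); rewrite ler_wpM2r// -powRM ?(ltW N0)//.
  apply: ge0_ler_powR; rewrite ?nnegrE ?mulr_ge0 ?(ltW N0)//.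
  by rewrite subr_ge0.
have : N <= (1 + e) `^ (s - 1) * A.
  by move: NC; rewrite -(mulr_powRB1 (ltW N0) s0) mulrAC ler_pM2r ?powR_gt0.
move=> /le_trans; apply; rewrite ler_wpM2r//.
by apply: ler_powR; rewrite ?lerDl// gerBl.
Qed.

Lemma le_of_1D_powR_le s (N A : R) : 0 < s -> 0 <= A ->
  (forall e, 0 < e -> N <= (1 + e) `^ s * A) -> N <= A.
Proof.
move=> s0 A0 h; apply/ler_addgt0Pr => z z0.
have A1 : 0 < A + 1 by rewrite ltr_wpDl.
(* [e] is chosen below so that [(1 + e) ^ s = 1 + t]; the excess [t * A] is then at most [z]. Adding
   [1] to [A] keeps the denominator positive when [A = 0]. *)
pose t := z / (A + 1); have t0 : 0 < t by rewrite divr_gt0.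
pose e := (1 + t) `^ s^-1 - 1.
have e1 : 1 + e = (1 + t) `^ s^-1 by rewrite /e addrC subrK.
have e0 : 0 < e.
  have powR1s : 1 `^ s^-1 = 1 :> R by rewrite powR1.
  rewrite -(ltrD2l 1) addr0 e1 -[ltLHS]powR1s.
  apply: gt0_ltr_powR; rewrite ?invr_gt0 ?nnegrE ?ltrDl//.
  by rewrite addr_ge0// ltW.
apply: (le_trans (h e e0)).
rewrite e1 -powRrM mulVf ?gt_eqF// powRr1; last by rewrite addr_ge0// ltW.
rewrite mulrDl mul1r lerD2l /t mulrAC ler_pdivrMr// ler_wpM2l ?(ltW z0)//.
by rewrite lerDl.
Qed.

(* For r = s finite the weights are c^(s - 1) / ||c||_s^(s - 1) with c running
   over the rational families (Hoelder); for r = +oo they are the coordinates. *)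
Lemma fin_lnorm_weights I r : (1 <= r)%E ->
  exists w : nat -> I -> R, [/\ forall j k, 0 <= w j k,
    forall j (u : I -> R), \sum_k w j k * `|u k| <= fin_lnorm r u &
    forall (a : I -> R) A, 0 <= A -> (forall k, 0 <= a k) ->
      (forall j, \sum_k w j k * a k <= A) -> fin_lnorm r a <= A].
Proof.
case: r => [s| |] // r1; last first.
  (* The form number [j] is evaluation at the index coded by [j]; a number that codes no index gives
     the zero form. *)
  exists (fun j k => (unpickle j == Some k)%:R); split => [//|j u|a A A0 a0 h].
    case: (unpickle j) => [i|]; last first.
      by rewrite big1 ?fin_lnorm_ge0// => k _; rewrite mul0r.
    rewrite (bigD1 i)//= eqxx mul1r big1 ?addr0.
      exact: (@normr_le_fin_lnorm _ +oo%E).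
    by move=> k ki; rewrite (inj_eq Some_inj) eq_sym (negbTE ki) mul0r.
  apply: bigmax_le => // k _; rewrite ger0_norm//.
  apply: le_trans (h (pickle k)).
  rewrite (bigD1 k)//= pickleK eqxx mul1r lerDl.
  by apply: sumr_ge0 => i _; rewrite mulr_ge0.
rewrite lee_fin in r1; have s0 := lt_le_trans ltr01 r1.
have s10 : 0 <= s - 1 by rewrite subr_ge0.
(* [c] enumerates the absolute values of all rational families; a number that codes none stands for
   the zero family. *)
pose c (j : nat) (k : I) : R :=
  `|ratr ((odflt 0 (unpickle j : option {ffun I -> rat})) k)|.
have c0 j k : 0 <= c j k by exact: normr_ge0.
exists (fun j k => c j k `^ (s - 1) / fin_lnorm s%:E (c j) `^ (s - 1)).
split => [j k|j u|a A A0 a0 h].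
- by rewrite divr_ge0 ?powR_ge0.
- under eq_bigr do rewrite mulrAC.
  rewrite -mulr_suml; have := fin_lnorm_hoelder u r1 (c0 j).
  move: (fin_lnorm s%:E (c j) `^ (s - 1))
    (powR_ge0 (fin_lnorm s%:E (c j)) (s - 1)).
  (* A zero denominator makes the weights vanish, since [0^-1 = 0], and the bound is trivial. *)
  move=> C C0 hC; have [->|Cn0] := eqVneq C 0.
    by rewrite invr0 mulr0 fin_lnorm_ge0.
  by rewrite ler_pdivrMr ?lt0r ?Cn0// mulrC.
- have [N_eq0|N_neq0] := eqVneq (fin_lnorm s%:E a) 0; first by rewrite N_eq0.
  have N0 : 0 < fin_lnorm s%:E a by rewrite lt0r N_neq0 fin_lnorm_ge0.
  apply: (le_of_1D_powR_le s0 A0) => e e0.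
  have [q [aq qa]] := rat_fin_lnorm_approx s0 a0 e0.
  (* The weights coded by a rational family [q] just above [a] nearly norm [a]: cleared of its
     denominator, [h j] bounds [\sum_k q k ^ (s - 1) * a k], which is at least the [s]-th power of
     the norm of [a]. *)
  pose j := pickle (finfun q : {ffun I -> rat}).
  have cE : c j = fun k => ratr (q k).
    apply/funext => k; rewrite /c /j pickleK/= ffunE ger0_norm//.
    exact: le_trans (aq k).
  have C0 : 0 < fin_lnorm s%:E (fun k => ratr (q k) : R).
    apply: lt_le_trans N0 _; apply: le_fin_lnorm => // k.
    by rewrite !ger0_norm// (le_trans _ (aq k)).
  apply: (le_of_powR_le r1 N0 (ltW C0) (ltW e0) A0 qa).
  have := h j; rewrite cE; under eq_bigr do rewrite mulrAC.
  rewrite -mulr_suml ler_pdivrMr; last exact: powR_gt0.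
  rewrite (mulrC A); apply: le_trans.
  rewrite powR_fin_lnorm ?gt_eqF//; apply: ler_sum => k _.
  rewrite (ger0_norm (a0 k)) -(mulr_powRB1 (a0 k) s0) mulrC ler_wpM2r//.
  by apply: ge0_ler_powR; rewrite ?nnegrE// (le_trans _ (aq k)).
Qed.

End fin_lnorm.

(** * The spaces [L^q] for [0 < q <= +oo] as solid vector spaces of functions *)

Section Lfun.
Context {R : realType} d (T : measurableType d).
Context (mu : {measure set T -> \bar R}) (q : \bar R) (q0 : (0 < q)%E).
Implicit Types f g : T -> R.

Lemma mem_LfunP f : f \in Lfun mu q <->
  measurable_fun setT f /\ ('N[mu]_q[EFin \o f] < +oo)%E.
Proof.
split=> [/andP[]|[mf Nf]]; first by rewrite !inE.
by apply/andP; rewrite !inE.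
Qed.

Lemma Lfun_measurable f : f \in Lfun mu q -> measurable_fun setT f.
Proof. by move=> /mem_LfunP[]. Qed.

Lemma measurable_normr_powR f (s : R) : measurable_fun setT f ->
  measurable_fun setT (fun x => `|f x| `^ s).
Proof.
move=> mf.
apply: (@measurableT_comp _ _ _ _ _ _ (@powR R ^~ s)) => //.
exact: measurableT_comp.
Qed.

Lemma ae_le_Lnorm f g : measurable_fun setT f -> measurable_fun setT g ->
  (\forall x \ae mu, `|f x| <= `|g x|) ->
  ('N[mu]_q[EFin \o f] <= 'N[mu]_q[EFin \o g])%E.
Proof.
rewrite unlock => mf mg; case: q q0 => [s| |] s0 fg; last by [].
  rewrite lte_fin in s0; apply: gt0_ler_poweR.
  - by rewrite invr_ge0 ltW.
  - rewrite in_itv/= leey andbT.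
    by apply: integral_ge0 => x _; rewrite lee_fin powR_ge0.
  - rewrite in_itv/= leey andbT.
    by apply: integral_ge0 => x _; rewrite lee_fin powR_ge0.
  apply: ae_ge0_le_integral => //.
  - by move=> x _; exact: poweR_ge0.
  - by apply/measurable_EFinP; exact: measurable_normr_powR.
  - by move=> x _; exact: poweR_ge0.
  - by apply/measurable_EFinP; exact: measurable_normr_powR.
  - apply: filterS fg => x fgx _ /=; rewrite lee_fin.
    by apply: ge0_ler_powR; rewrite ?nnegrE ?(ltW s0).
(* For [q = +oo] the norm is the essential supremum only if the whole space has positive measure,
   and [0] otherwise. *)
case: ifPn => // _; apply: le_ess_sup; apply: filterS fg => x fgx /=.
by rewrite lee_fin.
Qed.

Lemma le_Lfun f g : measurable_fun setT f -> g \in Lfun mu q ->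
  (forall x, `|f x| <= `|g x|) -> f \in Lfun mu q.
Proof.
move=> mf /mem_LfunP[mg Ng] fg; apply/mem_LfunP; split => //.
by apply: le_lt_trans Ng; apply: ae_le_Lnorm => //; exact: aeW.
Qed.

Lemma Lfun0 : (fun=> 0) \in Lfun mu q.
Proof. by apply/mem_LfunP; split => //; rewrite Lnorm0// gt_eqF. Qed.

Lemma Lfun_normr f : f \in Lfun mu q -> (fun x => `|f x|) \in Lfun mu q.
Proof.
move=> fq; apply: (le_Lfun _ fq) => [|x]; last by rewrite normr_id.
by apply: measurableT_comp => //; exact: Lfun_measurable.
Qed.

(* Unlike the library's closure lemmas this covers the quasi-normed range
   q < 1, by |f + g|^q <= 2^q (|f|^q + |g|^q). *)
Lemma Lfun_addf f g : f \in Lfun mu q -> g \in Lfun mu q ->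
  (fun x => f x + g x) \in Lfun mu q.
Proof.
move=> /mem_LfunP[mf Nf] /mem_LfunP[mg Ng]; apply/mem_LfunP; split.
  exact: measurable_funD.
move: mf mg Nf Ng; rewrite unlock; case: q q0 => [s| |] s0 mf mg Nf Ng.
- rewrite lte_fin in s0; have sV0 : s^-1 != 0 by rewrite gt_eqF ?invr_gt0.
  move: Nf Ng => /(lty_poweRy sV0) Nf /(lty_poweRy sV0) Ng; apply: poweR_lty.
  have /measurable_EFinP mf' := measurable_normr_powR s mf.
  have /measurable_EFinP mg' := measurable_normr_powR s mg.
  have mfg : measurable_fun setT (fun x => (`|f x| `^ s)%:E + (`|g x| `^ s)%:E)%E.
    by apply: emeasurable_funD.
  apply: (@le_lt_trans _ _ (\int[mu]_x
      ((2 `^ s)%:E * ((`|f x| `^ s)%:E + (`|g x| `^ s)%:E)))%E).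
    apply: ge0_le_integral => //.
    - by move=> x _; exact: poweR_ge0.
    - apply/measurable_EFinP/(@measurable_normr_powR (fun x => f x + g x)).
      exact: measurable_funD.
    - exact: measurable_funeM.
    - move=> x _; rewrite /= lee_fin.
      (* [|f + g| <= 2 M], and [M ^ s] is one of the two summands on the right. *)
      set M := Num.max `|f x| `|g x|.
      have M0 : 0 <= M by rewrite le_max normr_ge0.
      apply: (@le_trans _ _ ((2 * M) `^ s)).
        apply: ge0_ler_powR; rewrite ?nnegrE ?(ltW s0) ?mulr_ge0//.
        apply: (le_trans (ler_normD _ _)); rewrite mulr_natl mulr2n.
        by rewrite lerD// le_max lexx ?orbT.
      rewrite powRM// ler_wpM2l ?powR_ge0// /M maxEle.
      by case: ifP => _; rewrite ?lerDl ?lerDr powR_ge0.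
  have fs0 x : [set: T] x -> (0 <= (`|f x| `^ s)%:E)%E.
    by rewrite lee_fin powR_ge0.
  have gs0 x : [set: T] x -> (0 <= (`|g x| `^ s)%:E)%E.
    by rewrite lee_fin powR_ge0.
  have fgs0 x : [set: T] x -> (0 <= (`|f x| `^ s)%:E + (`|g x| `^ s)%:E)%E.
    by move=> xT; exact: adde_ge0 (fs0 x xT) (gs0 x xT).
  have s20 : (0 <= (2 `^ s)%:E :> \bar R)%E by rewrite lee_fin powR_ge0.
  rewrite (ge0_integralZl _ measurableT mfg fgs0 s20).
  rewrite lte_mul_pinfty//.
  rewrite (ge0_integralD _ measurableT fs0 mf' gs0 mg').
  apply: lte_add_pinfty; [exact: Nf|exact: Ng].
- move: Nf Ng; case: ifPn => // muT Nf Ng.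
    apply: (@le_lt_trans _ _ (ess_sup mu (abse \o (EFin \o f)) +
                              ess_sup mu (abse \o (EFin \o g)))%E).
      exact: (ess_sup_absD mu (EFin \o f) (EFin \o g)).
    exact: lte_add_pinfty.
- by [].
Qed.

(** Natural multiples are iterated sums, and [a * f] is dominated by the multiple of [f] by a
    natural number above [|a|]. *)
Lemma Lfun_scalef (a : R) f : f \in Lfun mu q -> (fun x => a * f x) \in Lfun mu q.
Proof.
have nat_scale n g : g \in Lfun mu q -> (fun x => n%:R * g x) \in Lfun mu q.
  move=> gq; elim: n => [|n ih].
    by under eq_fun do rewrite mul0r; exact: Lfun0.
  by under eq_fun do rewrite -natr1 mulrDl mul1r; exact: Lfun_addf.
move=> fq; apply: (le_Lfun _ (nat_scale (Num.trunc `|a|).+1 _ fq)) => [|x].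
  by apply: measurable_funM => //; exact: Lfun_measurable.
rewrite !normrM normr_nat ler_wpM2r//; apply: ltW; exact: truncnS_gt.
Qed.

Lemma Lfun_lincomb I (s : seq I) (w : I -> R) (f : I -> T -> R) :
  (forall k, f k \in Lfun mu q) ->
  (fun x => \sum_(k <- s) w k * f k x) \in Lfun mu q.
Proof.
move=> fq; elim: s => [|k s ih].
  by under eq_fun do rewrite big_nil; exact: Lfun0.
by under eq_fun do rewrite big_cons; apply: Lfun_addf => //; exact: Lfun_scalef.
Qed.

End Lfun.

(** * Pointwise [l^r] norms of finite families of functions *)

Lemma measurable_fin_lnorm {R : realType} d (T : measurableType d)
    (I : finType) (r : \bar R) (f : I -> T -> R) :
  (forall k, measurable_fun setT (f k)) ->
  measurable_fun setT (fun x => fin_lnorm r (fun k => f k x)).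
Proof.
move=> mf; case: r => [s| |] //.
  apply: (@measurableT_comp _ _ _ _ _ _ (@powR R ^~ s^-1)) => //.
  apply: measurable_sum => k.
  exact: measurable_normr_powR.
rewrite /fin_lnorm; elim: (index_enum I) => [|k s ih].
  by under eq_fun do rewrite big_nil; exact: measurable_cst.
under eq_fun do rewrite big_cons.
apply: measurable_maxr; [exact: measurableT_comp|exact: ih].
Qed.

(** For [r >= 1] the pointwise norm is dominated by [\sum_k |f k|], which lies in [L^q] as a linear
    combination with weights [1]. *)
Lemma Lfun_fin_lnorm {R : realType} d (T : measurableType d)
    (mu : {measure set T -> \bar R}) (q : \bar R) (I : finType) (r : \bar R)
    (f : I -> T -> R) : (0 < q)%E -> (1 <= r)%E ->
  (forall k, f k \in Lfun mu q) ->
  (fun x => fin_lnorm r (fun k => f k x)) \in Lfun mu q.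
Proof.
move=> q0 r1 fq.
have sq := Lfun_lincomb q0 (index_enum I) (fun=> 1) (fun k => Lfun_normr q0 (fq k)).
apply: (le_Lfun q0 _ sq) => [|x].
  by apply: measurable_fin_lnorm => k; exact: Lfun_measurable (fq k).
rewrite ger0_norm ?fin_lnorm_ge0// (le_trans (fin_lnorm_le_sum _ r1))//.
by under eq_bigr do rewrite -[`|_|]mul1r; exact: ler_norm.
Qed.

(** * Tuples with one slot replaced, and equality almost everywhere *)

Lemma dfwith_ind (I : eqType) (F : I -> Type) (P : forall i, F i -> Prop)
    (f : forall i, F i) (i : I) (x : F i) :
  P i x -> (forall j, i != j -> P j (f j)) -> forall j, P j (dfwith f i x j).
Proof. by move=> Px Pf j; case: dfwithP => // k /Pf. Qed.

Lemma eq_dfwith (I : eqType) (F : I -> Type) (f g : forall i, F i) (i : I)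
    (x : F i) :
  g i = x -> (forall j, i != j -> g j = f j) -> g = dfwith f i x.
Proof.
move=> gi gj; apply: functional_extensionality_dep => j.
by case: dfwithP => [|k ik]; [exact: gi|exact: gj].
Qed.

Lemma ae_eq_setT {R : realType} d (T : measurableType d)
    (mu : {measure set T -> \bar R}) (U : Type) (f g : T -> U) :
  f = g %[ae mu] <-> \forall x \ae mu, f x = g x.
Proof. by split; apply: filterS => x; [exact|]. Qed.

(** * Positive multilinear operators: slotwise estimates and the operator norm *)

Section positive_operator.
Context (R : realType) (m : nat)
  (d : 'I_m -> measure_display) (X : forall i, measurableType (d i))
  (mu : forall i, {sigma_finite_measure set (X i) -> \bar R})
  (d' : measure_display) (Y : measurableType d')
  (nu : {sigma_finite_measure set Y -> \bar R})
  (p : \bar R) (q : 'I_m -> \bar R)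
  (hp : (0 < p)%E) (hq : forall i, (0 < q i)%E)
  (T : (forall i, X i -> R) -> Y -> R)
  (hT : multilinear_operator mu q nu p T) (T_ge0 : positive_operator mu q nu T).
Implicit Types (f g : forall i, X i -> R) (i : 'I_m).

Local Notation Lq i := (Lfun (mu i) (q i)).

Lemma Lfun_tuple_dfwith f i (u : X i -> R) :
  Lfun_tuple mu q f -> u \in Lq i -> Lfun_tuple mu q (dfwith f i u).
Proof. by move=> fq uq j; case: dfwithP. Qed.

(** The combination enters through a pointwise equation for [w], so that any function with such a
    decomposition can be inserted as it stands. *)
Lemma operator_linear f i (a : R) (u v w : X i -> R) :
  Lfun_tuple mu q f -> u \in Lq i -> v \in Lq i ->
  (forall x, w x = a * u x + v x) ->
  \forall y \ae nu, T (dfwith f i w) y =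
    a * T (dfwith f i u) y + T (dfwith f i v) y.
Proof.
move=> fq uq vq /funext ->; apply/ae_eq_setT.
exact: (multilinear_operator_linear hT).
Qed.

Lemma operator0 f i : Lfun_tuple mu q f ->
  \forall y \ae nu, T (dfwith f i (fun=> 0)) y = 0.
Proof.
move=> fq; have zq := Lfun0 (mu i) (hq i).
have z0 (x : X i) : 0 = 1 * 0 + 0 :> R by rewrite mul1r addr0.
apply: filterS (operator_linear fq zq zq z0) => y.
by rewrite mul1r -{1}[T _ y]addr0 => /addrI.
Qed.

Lemma operator_sum f i (I : Type) (s : seq I) (w : I -> R) (u : I -> X i -> R) :
  Lfun_tuple mu q f -> (forall k, u k \in Lq i) ->
  \forall y \ae nu, T (dfwith f i (fun x => \sum_(k <- s) w k * u k x)) y =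
    \sum_(k <- s) w k * T (dfwith f i (u k)) y.
Proof.
move=> fq uq; elim: s => [|k s ih].
  have -> : (fun x => \sum_(k <- [::]) w k * u k x) = fun=> 0.
    by apply/funext => x; rewrite big_nil.
  by apply: filterS (operator0 i fq) => y ->; rewrite big_nil.
have sum_cons x : \sum_(j <- k :: s) w j * u j x =
    w k * u k x + \sum_(j <- s) w j * u j x by rewrite big_cons.
have := operator_linear fq (uq k) (Lfun_lincomb (hq i) s w uq) sum_cons.
by apply: filterS2 ih => y ih ->; rewrite ih big_cons.
Qed.

Lemma operator_ge0 f : Lfun_tuple mu q f -> (forall i x, 0 <= f i x) ->
  \forall y \ae nu, 0 <= T f y.
Proof. by move=> fq f0; apply: T_ge0 => // i; apply: aeW => x; exact: f0. Qed.

(** Positivity is applied to the tuple with [v - u] in slot [i], and linearity in that slot gives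
    the comparison. *)
Lemma le_operator f i (u v : X i -> R) : Lfun_tuple mu q f ->
  (forall j x, i != j -> 0 <= f j x) -> u \in Lq i -> v \in Lq i ->
  (forall x, u x <= v x) ->
  \forall y \ae nu, T (dfwith f i u) y <= T (dfwith f i v) y.
Proof.
move=> fq f0 uq vq uv.
have wq : (fun x => v x - u x) \in Lq i.
  have := Lfun_addf (hq i) vq (Lfun_scalef (hq i) (-1) uq).
  by under eq_fun do rewrite mulN1r.
have w0 : \forall y \ae nu, 0 <= T (dfwith f i (fun x => v x - u x)) y.
  apply: operator_ge0; first exact: Lfun_tuple_dfwith.
  apply: (@dfwith_ind _ _ (fun j u => forall x, 0 <= u x)) => [x|j ij x].
    by rewrite subr_ge0.
  exact: f0.
have vE x : v x = 1 * (v x - u x) + u x by rewrite mul1r subrK.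
apply: filterS2 w0 (operator_linear fq wq uq vE) => y y0 ->.
by rewrite mul1r lerDr.
Qed.

(* The slots are split one at a time as f = f^+ - f^-; [s] lists those not yet
   split, outside of which f is nonnegative. *)
Lemma norm_operator_le f : Lfun_tuple mu q f ->
  \forall y \ae nu, `|T f y| <= T (fun i x => `|f i x|) y.
Proof.
suff H (s : seq 'I_m) f0 : Lfun_tuple mu q f0 ->
    (forall i x, i \notin s -> 0 <= f0 i x) ->
    \forall y \ae nu, `|T f0 y| <= T (fun i x => `|f0 i x|) y.
  move=> fq; apply: (H (enum 'I_m)) => // i x.
  by rewrite mem_enum.
elim: s f0 => [|i s ih] {}f fq f0.
  have -> : (fun i x => `|f i x|) = f.
    apply: functional_extensionality_dep => i; apply/funext => x.
    by rewrite ger0_norm ?f0.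
  apply: filterS (operator_ge0 fq _) => [y y0|i x]; last exact: f0.
  by rewrite ger0_norm.
pose P x := Num.max (f i x) 0; pose N x := Num.max (- f i x) 0.
have P0 x : 0 <= P x by rewrite le_max lexx orbT.
have N0 x : 0 <= N x by rewrite le_max lexx orbT.
have mf := Lfun_measurable (fq i).
have Pq : P \in Lq i.
  apply: (le_Lfun (hq i) _ (fq i)) => [|x].
    by apply: measurable_maxr => //; exact: measurable_cst.
  by rewrite ger0_norm// ge_max normr_ge0 ler_norm.
have Nq : N \in Lq i.
  apply: (le_Lfun (hq i) _ (fq i)) => [|x].
    apply: measurable_maxr; [exact: measurableT_comp|exact: measurable_cst].
  by rewrite ger0_norm// ge_max normr_ge0 -normrN ler_norm.
(* Both [f i] and [|f i|] are combinations of the negative part [N] and the positive part [P],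
   differing only in the coefficient of [N]. *)
have fPN x : f i x = -1 * N x + P x.
  by rewrite /P /N mulN1r !maxEle oppr_le0; case: ifP => h1; case: ifP => h2; lra.
have absfPN x : `|f i x| = 1 * N x + P x.
  rewrite /P /N mul1r !maxEle oppr_le0.
  by case: (ger0P (f i x)) => h /=; case: ifP => h1; lra.
(* A tuple is its own update, which turns the linearity statements below into statements about [T f]
   and [T |f|]. *)
have f_dfwith g : g = dfwith g i (g i).
  exact: (@eq_dfwith _ (fun i => X i -> R) g g i (g i) erefl (fun _ _ => erefl)).
have absfq : Lfun_tuple mu q (fun j x => `|f j x|).
  by move=> j; exact: Lfun_normr.
have abs_with (u : X i -> R) : (forall x, 0 <= u x) ->
    (fun j x => `|dfwith f i u j x|) = dfwith (fun j x => `|f j x|) i u.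
  move=> u0; apply: eq_dfwith => [|j ij].
    by apply/funext => x; rewrite dfwithin ger0_norm.
  by apply/funext => x; rewrite dfwithout.
have ihu (u : X i -> R) : u \in Lq i -> (forall x, 0 <= u x) ->
    \forall y \ae nu, `|T (dfwith f i u) y| <=
      T (dfwith (fun j x => `|f j x|) i u) y.
  move=> uq u0; rewrite -(abs_with u u0).
  apply: ih => [|j x js]; first exact: Lfun_tuple_dfwith.
  move: j x js; apply: (@dfwith_ind _ _
    (fun j u => forall x, j \notin s -> 0 <= u x)) => [x _|j ij x js] //.
  by apply: f0; rewrite inE negb_or eq_sym ij.
(* [|T f|] is at most the sum of the absolute values of [T] at [N] and at [P] in slot [i]; by
   induction this is at most the sum of the values with [|f|] in the other slots, which is
   [T |f|]. *)
have lin1 := operator_linear fq Nq Pq fPN.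
have lin2 := operator_linear absfq Nq Pq absfPN.
rewrite -f_dfwith in lin1.
rewrite -(f_dfwith (fun j x => `|f j x|)) in lin2.
have ihPN : \forall y \ae nu, `|T (dfwith f i N) y| + `|T (dfwith f i P) y| <=
    T (dfwith (fun j x => `|f j x|) i N) y + T (dfwith (fun j x => `|f j x|) i P) y.
  by apply: filterS2 (ihu N Nq N0) (ihu P Pq P0) => y; exact: lerD.
apply: filterS3 lin1 lin2 ihPN => y -> ->; rewrite mul1r mulN1r; apply: le_trans.
by rewrite -(normrN (T (dfwith f i N) y)) ler_normD.
Qed.

Lemma fin_lnorm_operator_le f i (I : finType) (r : \bar R) (u : I -> X i -> R) :
  (1 <= r)%E -> Lfun_tuple mu q f -> (forall j x, i != j -> 0 <= f j x) ->
  (forall k, u k \in Lq i) -> (forall k x, 0 <= u k x) ->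
  \forall y \ae nu, fin_lnorm r (fun k => T (dfwith f i (u k)) y) <=
    T (dfwith f i (fun x => fin_lnorm r (fun k => u k x))) y.
Proof.
move=> r1 fq f0 uq u0.
have [w [w0 wle wge]] := fin_lnorm_weights I r1.
set G := fun x => fin_lnorm r (fun k => u k x).
have Gq : G \in Lq i by exact: Lfun_fin_lnorm.
have with0 (v : X i -> R) : v \in Lq i -> (forall x, 0 <= v x) ->
    \forall y \ae nu, 0 <= T (dfwith f i v) y.
  move=> vq v0; apply: operator_ge0; first exact: Lfun_tuple_dfwith.
  by apply: (@dfwith_ind _ _ (fun j u => forall x, 0 <= u x)) => // j ij x; exact: f0.
have TG0 := with0 G Gq (fun x => fin_lnorm_ge0 r (fun k => u k x)).
have Tu0 : \forall y \ae nu, forall k, 0 <= T (dfwith f i (u k)) y.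
  by apply: filter_forall => k; exact: with0.
have Tw : \forall y \ae nu, forall j,
    \sum_k w j k * T (dfwith f i (u k)) y <= T (dfwith f i G) y.
  (* Each form has its own exceptional null set; since there are countably many forms, one null set
     serves for all of them. *)
  apply: ae_foralln => j.
  have sum_le x : \sum_k w j k * u k x <= G x.
    apply: le_trans (wle j (fun k => u k x)).
    by apply: ler_sum => k _; rewrite ger0_norm.
  have := le_operator fq f0 (Lfun_lincomb (hq i) (index_enum I) (w j) uq) Gq sum_le.
  by apply: filterS2 (operator_sum (index_enum I) (w j) fq uq) => y ->.
by apply: filterS3 TG0 Tu0 Tw => y; exact: wge.
Qed.

(** Induction on the list [s] of slots already treated: [F s k] carries the norm [G i] in these
    slots and [|f i (k i)|] in the others. It is compared with the norm over the multi-indices that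
    agree with [k] outside [s], the remaining entries being set to [0] so that the index type stays
    fixed. *)
Lemma fin_lnorm_multilinear_le (n : 'I_m -> nat)
    (f : forall i, 'I_(n i) -> X i -> R) (r : \bar R) : (1 <= r)%E ->
  (forall i k, f i k \in Lq i) ->
  \forall y \ae nu, fin_lnorm r (fun k : {dffun forall i : 'I_m, 'I_(n i)} =>
      T (fun i => f i (k i)) y) <=
    T (fun i x => fin_lnorm r (fun k => f i k x)) y.
Proof.
move=> r1 fq; have r0 : (0 < r)%E by exact: lt_le_trans r1.
set G := fun i x => fin_lnorm r (fun k => f i k x).
have Gq : Lfun_tuple mu q G by move=> i; exact: Lfun_fin_lnorm.
pose F (s : seq 'I_m) (k : {dffun forall i : 'I_m, 'I_(n i)}) i : X i -> R :=
  if i \in s then G i else fun x => `|f i (k i) x|.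
have Fq s k : Lfun_tuple mu q (F s k).
  by move=> i; rewrite /F; case: ifP => _; [exact: Gq|exact: Lfun_normr].
have F0 s k i x : 0 <= F s k i x.
  by rewrite /F; case: ifP => _; rewrite ?fin_lnorm_ge0.
(* [agree s k k'] says that k' differs from k at most on the slots in [s],
   that is, on those already filled with the norms G. *)
pose agree (s : seq 'I_m) (k k' : {dffun forall i : 'I_m, 'I_(n i)}) :=
  [forall j, (j \in s) || (k' j == k j)].
suff H s : uniq s -> forall k, \forall y \ae nu,
    fin_lnorm r (fun k' => if agree s k k' then T (fun i => f i (k' i)) y else 0)
    <= T (F s k) y.
  have FG k : F (enum 'I_m) k = G.
    by apply: functional_extensionality_dep => i; rewrite /F mem_enum.
  (* There is no multi-index at all if some [n i] is [0]; the left side is then [0], and positivity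
     of [T] suffices. *)
  have [k _|K0] := pickP (fun k : {dffun forall i : 'I_m, 'I_(n i)} => true).
    have := H (enum 'I_m) (enum_uniq _) k; rewrite FG; apply: filterS => y.
    apply: le_trans; apply: le_fin_lnorm => // k'.
    by rewrite ifT//; apply/forallP => j; rewrite mem_enum.
  apply: filterS (operator_ge0 Gq (fun i x => fin_lnorm_ge0 r _)) => y.
  apply: le_trans; apply: (le_trans (fin_lnorm_le_sum _ r1)).
  by rewrite big1// => k; have := K0 k.
(* For the empty list only the entry at [k] survives, and the claim is [|T f| <= T |f|]. *)
elim: s => [_ k|i s ih /= /andP[is_ us] k].
  have := norm_operator_le (fun i => fq i (k i)); apply: filterS => y.
  apply: le_trans; apply: (le_trans (fin_lnorm_le_sum _ r1)).
  rewrite (bigD1 k)//= ifT; last by apply/forallP => j; rewrite eqxx orbT.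
  rewrite big1 ?addr0// => k' k'k; rewrite ifF ?normr0//.
  apply/negP => /forallP kk'; move/eqP: k'k; apply.
  by apply/ffunP => j; have /eqP := kk' j.
(* As [i] is not in [s], varying the index of slot [i] changes [F s k] in that slot only, so the
   one-slot estimate leads from the tuples [F s (upd l)] to [F (i :: s) k]. *)
pose upd (l : 'I_(n i)) : {dffun forall i : 'I_m, 'I_(n i)} := finfun (dfwith k i l).
have updE l j : upd l j = dfwith k i l j by rewrite ffunE.
have Fupd l : F s (upd l) = dfwith (F s k) i (fun x => `|f i l x|).
  apply: eq_dfwith => [|j ij]; rewrite /F.
    by rewrite (negbTE is_) updE dfwithin.
  by rewrite updE dfwithout.
have Fcons : F (i :: s) k =
    dfwith (F s k) i (fun x => fin_lnorm r (fun l => `|f i l x|)).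
  apply: eq_dfwith => [|j ij]; rewrite /F inE ?eqxx//=.
    apply/funext => x; apply/eqP; rewrite eq_le.
    by apply/andP; split; apply: le_fin_lnorm => // l; rewrite normr_id.
  by rewrite eq_sym (negbTE ij).
have {ih} : \forall y \ae nu, forall l,
    fin_lnorm r (fun k' =>
      if agree s (upd l) k' then T (fun i => f i (k' i)) y else 0) <=
    T (dfwith (F s k) i (fun x => `|f i l x|)) y.
  by apply: filter_forall => l; rewrite -Fupd; exact: ih.
have := fin_lnorm_operator_le r1 (Fq s k) (fun j x _ => F0 s k j x)
  (fun l => Lfun_normr (hq i) (fq i l)) (fun l x => normr_ge0 (f i l x)).
rewrite -Fcons; apply: filterS2 => y step ih.
apply: le_trans step; pose c l (k' : {dffun forall i : 'I_m, 'I_(n i)}) : R :=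
  if agree s (upd l) k' then T (fun i => f i (k' i)) y else 0.
(* Multi-indices are grouped by their coordinate at [i]: one that agrees with [k] outside [i :: s]
   agrees with [upd (k' i)] outside [s]. *)
apply: (@le_trans _ _ (fin_lnorm r (fun l => fin_lnorm r (c l)))).
  apply: (@fin_lnorm_fibers _ {dffun forall i : 'I_m, 'I_(n i)} 'I_(n i) r
    (fun k' => k' i) _ c) => // k'.
  case: ifP => [/forallP kk'|]; last by rewrite normr0.
  rewrite /c ifT//; apply/forallP => j; rewrite updE.
  have [<-|ij] := eqVneq i j; first by rewrite dfwithin eqxx orbT.
  by have := kk' j; rewrite inE eq_sym (negbTE ij)/= dfwithout.
apply: le_fin_lnorm => // l; rewrite ger0_norm ?fin_lnorm_ge0//.
exact: le_trans (ih l) (ler_norm _).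
Qed.

(** A slot of norm zero is almost everywhere zero, so compatibility with equality almost everywhere
    and linearity annihilate [T f]. This settles the case of a vanishing product, where
    [+oo * 0 = 0] would make the bound fail for a nonzero [T f]. *)
Lemma Lnorm_operator_eq0 f i : Lfun_tuple mu q f ->
  ('N[mu i]_(q i)[EFin \o f i] = 0 -> 'N[nu]_p[EFin \o T f] = 0)%E.
Proof.
move=> fq fi0.
have fi_eq0 : f i = (fun=> 0) %[ae mu i].
  have mf : measurable_fun setT (EFin \o f i).
    by apply/measurable_EFinP; exact: Lfun_measurable (fq i).
  by apply: filterS (Lnorm_eq0_eq0 mf (hq i) fi0) => x /[apply] -[].
have zq : Lfun_tuple mu q (dfwith f i (fun=> 0)).
  by apply: Lfun_tuple_dfwith => //; exact: Lfun0.
have fz j : f j = dfwith f i (fun=> 0) j %[ae mu j].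
  move: j; apply: (@dfwith_ind _ (fun i => X i -> R)
    (fun j u => f j = u %[ae mu j])) => // j ij.
  exact: ae_eq_refl.
have /ae_eq_setT Tfz := multilinear_operator_ae_eq hT fq zq fz.
apply/eqP; rewrite eq_le Lnorm_ge0 andbT.
rewrite -(@Lnorm0 _ _ _ nu p) ?gt_eqF//.
apply: (@ae_le_Lnorm _ _ _ nu p hp _ (fun=> 0)) => //.
  exact: Lfun_measurable (multilinear_operator_Lfun hT fq).
by apply: filterS2 Tfz (operator0 i fq) => y -> ->.
Qed.

Lemma Lnorm_operator_le f : Lfun_tuple mu q f ->
  ('N[nu]_p[EFin \o T f] <=
    operator_norm mu q nu p T * \big[*%E/1]_(i < m) 'N[mu i]_(q i)[EFin \o f i])%E.
Proof.
move=> fq; pose a i := fine ('N[mu i]_(q i)[EFin \o f i]).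
have aE i : ('N[mu i]_(q i)[EFin \o f i] = (a i)%:E)%E.
  rewrite /a fineK// ge0_fin_numE ?Lnorm_ge0//.
  by have /mem_LfunP[] := fq i.
have a0 i : 0 <= a i by rewrite fine_ge0// Lnorm_ge0.
have prodE : (\big[*%E/1]_(i < m) 'N[mu i]_(q i)[EFin \o f i] = (\prod_i a i)%:E)%E.
  by rewrite -prodEFin; apply: eq_bigr => i _; exact: aE.
have [a_eq0|a_neq0] := eqVneq (\prod_i a i) 0.
  rewrite prodE a_eq0 mule0; move/eqP: a_eq0; rewrite prodf_seq_eq0.
  by move=> /hasP[i _ /eqP ai0]; rewrite (@Lnorm_operator_eq0 f i)// aE ai0.
have ap : 0 < \prod_i a i by rewrite lt0r a_neq0 prodr_ge0.
(* Division by the positive product reduces the claim to a lower bound for all admissible constants;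
   it also covers the case where there are none and the infimum is [+oo]. *)
rewrite prodE -lee_pdivrMr//; apply/ereal_infP => _ [M [M0 MT] <-].
by rewrite lee_pdivrMr// -prodE; exact: MT.
Qed.

End positive_operator.

Theorem proposition1p9 (R : realType) (m : nat)
  (d : 'I_m -> measure_display) (X : forall i, measurableType (d i))
  (mu : forall i, {sigma_finite_measure set (X i) -> \bar R})
  (d' : measure_display) (Y : measurableType d')
  (nu : {sigma_finite_measure set Y -> \bar R})
  (p : \bar R) (q : 'I_m -> \bar R) (r : \bar R)
  (hp : (0 < p)%E) (hq : forall i, (0 < q i)%E) (hr : (1 <= r)%E)
  (T : (forall i, X i -> R) -> Y -> R)
  (hT : multilinear_operator mu q nu p T) (T_ge0 : positive_operator mu q nu T)
  (n : 'I_m -> nat) (f : forall i, 'I_(n i) -> X i -> R)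
  (hf : forall i k, f i k \in Lfun (mu i) (q i)) :
  ('N[nu]_p[EFin \o (fun y =>
      fin_lnorm r (fun k : {dffun forall i : 'I_m, 'I_(n i)} =>
        T (fun i => f i (k i)) y))] <=
   operator_norm mu q nu p T *
   \big[*%E/1]_(i < m) 'N[mu i]_(q i)[EFin \o (fun x =>
      fin_lnorm r (fun k : 'I_(n i) => f i k x))])%E.
Proof.
have hG : Lfun_tuple mu q (fun i x => fin_lnorm r (fun k => f i k x)).
  by move=> i; exact: Lfun_fin_lnorm.
apply: le_trans (Lnorm_operator_le hp hq hT hG).
have mT := Lfun_measurable (multilinear_operator_Lfun hT hG).
apply: (ae_le_Lnorm hp _ mT).
  apply: measurable_fin_lnorm => k.
  by apply/Lfun_measurable/(multilinear_operator_Lfun hT) => i; exact: hf.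
apply: filterS (fin_lnorm_multilinear_le hq hT T_ge0 hr hf) => y le_y.
rewrite ger0_norm ?fin_lnorm_ge0//; exact: le_trans le_y (ler_norm _).
Qed.
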